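(* Let $A=\{a_1,\dots,a_n\}$ and $B=\{b_1,\dots,b_m\}$ be a pair of multicurves on a surface, with intersection matrix $\Omega=\Omega(A,B)$, and let $\Gamma(\Omega)$ be the associated matrix monoid. If $M\in\Gamma(\Omega)$, then $M$ has no (complex) eigenvalue on the unit circle except possibly $1$.
   Context: A multicurve is a collection of pairwise disjoint simple closed curves. Put $(e_1,\dots,e_{n+m})=(a_1,\dots,a_n,b_1,\dots,b_m)$. The intersection matrix $\Omega=\Omega(A,B)$ is the symmetric $(n+m)\times(n+m)$ nonnegative integer matrix whose $(j,k)$-entry is the geometric intersection number $i(e_j,e_k)$; in particular its diagonal entries are zero, and $i(a_j,a_k)=0$, $i(b_j,b_k)=0$ for all $j,k$. For $1\le i\le n+m$ let $D_i$ be the $(n+m)\times(n+m)$ matrix whose $i$th diagonal entry is $1$ and all of whose other entries are $0$, and let $Q_i=I+D_i\Omega$, where $I$ is the identity matrix. $\Gamma(\Omega)=\langle Q_i : 1\le i\le n+m\rangle$ is the monoid generated by the $Q_i$ under matrix multiplication. *)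

(* Defs.v *)
From mathcomp Require Export all_boot all_order all_algebra.
From mathcomp Require Export all_classical all_reals all_analysis.
From mathcomp Require Export complex.

Set Implicit Arguments.
Unset Strict Implicit.
Unset Printing Implicit Defensive.

Import Order.TTheory GRing.Theory Num.Theory numFieldNormedType.Exports.

Local Open Scope classical_set_scope.
Local Open Scope card_scope.
Local Open Scope ring_scope.

Section Surfaces.
Context {R : realType} (S : topologicalType).

Definition half_plane : set (R * R) := [set p | 0 <= p.2].

(* [f] restricts to a homeomorphism from [U] onto [V], with inverse [g]. *)
Definition homeo_between (X Y : topologicalType) (U : set X) (V : set Y)
    (f : X -> Y) (g : Y -> X) : Prop :=
  [/\ set_fun U V f, set_fun V U g, {in U, cancel f g}, {in V, cancel g f}
    & {within U, continuous f} /\ {within V, continuous g}].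

(* Boundary, punctures and several components are allowed, and no
   orientability is assumed.  The open subsets of the closed half-plane include
   the open discs, so interior points are covered by the same clause. *)
Definition is_surface : Prop :=
  [/\ hausdorff_space S, @second_countable S &
    forall x : S, exists (U : set S) (W : set (R * R)) f g,
      [/\ open U, U x, open W & homeo_between U (W `&` half_plane) f g]].

Definition unit_circle : set (R * R) :=
  [set p | p.1 ^+ 2 + p.2 ^+ 2 = 1].

(* Curves are total functions on the plane; only their values on the unit
   circle matter. *)
Definition simple_closed_curve (c : R * R -> S) : Prop :=
  {within unit_circle, continuous c} /\ set_inj unit_circle c.

Definition freely_homotopic (c d : R * R -> S) : Prop :=
  exists H : R * (R * R) -> S,
    [/\ {within `[0, 1]%classic `*` unit_circle, continuous H},
        forall p, unit_circle p -> H (0, p) = c p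
      & forall p, unit_circle p -> H (1, p) = d p].

Definition meet_in (c d : R * R -> S) (k : nat) : Prop :=
  exists c' d',
    [/\ simple_closed_curve c', simple_closed_curve d',
        freely_homotopic c c', freely_homotopic d d'
      & c' @` unit_circle `&` d' @` unit_circle #= `I_k].

(* The representatives are simple closed curves, so each point of the
   intersection is passed once by each curve.  Reversing the orientation of
   a curve does not change the images of its representatives.  The default
   value 0 of [xget] would be used only if no two representatives had finite
   intersection, which does not happen on a surface. *)
Definition geometric_intersection (c d : R * R -> S) : nat :=
  xget 0%N [set k | meet_in c d k /\ forall l, meet_in c d l -> (k <= l)%N].

Definition multicurve (n : nat) (c : 'I_n -> R * R -> S) : Prop :=
  (forall i, simple_closed_curve (c i)) /\
  trivIset [set: 'I_n] (fun i => c i @` unit_circle).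

Definition join_curves (n m : nat) (a : 'I_n -> R * R -> S)
    (b : 'I_m -> R * R -> S) (k : 'I_(n + m)) : R * R -> S :=
  match fintype.split k with inl i => a i | inr j => b j end.

Definition intersection_matrix (n m : nat) (a : 'I_n -> R * R -> S)
    (b : 'I_m -> R * R -> S) : 'M[int]_(n + m) :=
  \matrix_(j, k)
    (geometric_intersection (join_curves a b j) (join_curves a b k))%:Z.

End Surfaces.

Section MatrixMonoid.
Context (N : nat) (Omega : 'M[int]_N).

Definition Qmx (i : 'I_N) : 'M[int]_N := 1%:M + delta_mx i i *m Omega.

Definition is_mx_submonoid (G : set 'M[int]_N) : Prop :=
  G 1%:M /\ forall A B, G A -> G B -> G (A *m B).

Definition matrix_monoid : set 'M[int]_N :=
  smallest is_mx_submonoid (range Qmx).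

End MatrixMonoid.

(* Main.v *)
(** The Hermitian form [h v = v^* Omega v] does not decrease along the monoid:
    [h (Q_i v) = h v + (2 + Omega_ii) |(Omega v)_i|^2], with equality
    [h (Q_i v) = h v] only if [Q_i v = v].  If [M v = z v] with [|z| = 1] then
    [h (M v) = h v], so every factor of [M] fixes [v] and [z = 1].  The diagonal
    of [Omega] is kept, since a one-sided curve on a non-orientable surface may
    have nonzero intersection number with itself. *)
Require Import Defs.
From mathcomp Require Import all_boot all_order all_algebra.
From mathcomp Require Import all_classical all_reals all_analysis.
From mathcomp Require Import complex.
From mathcomp Require Import ring.
Import Order.TTheory GRing.Theory Num.Theory.
Local Open Scope ring_scope.
Local Open Scope complex_scope.

Section HermitianForm.
Variables (C : numClosedFieldType) (N : nat) (Omega : 'M[int]_N).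

Definition intmx (A : 'M[int]_N) : 'M[C]_N := map_mx (fun k : int => k%:~R) A.

Definition hform (x y : 'cV[C]_N) : C :=
  ((map_mx Num.conj x)^T *m intmx Omega *m y) 0 0.

Lemma hformDl x y w : hform (x + y) w = hform x w + hform y w.
Proof. by rewrite /hform map_mxD linearD /= !mulmxDl mxE. Qed.

Lemma hformDr x y w : hform w (x + y) = hform w x + hform w y.
Proof. by rewrite /hform mulmxDr mxE. Qed.

Lemma hformZl c x y : hform (c *: x) y = Num.conj c * hform x y.
Proof. by rewrite /hform map_mxZ linearZ /= -!scalemxAl mxE. Qed.

Lemma hformZr c x y : hform x (c *: y) = c * hform x y.
Proof. by rewrite /hform -scalemxAr mxE. Qed.

Lemma hform_deltal i y : hform (delta_mx i 0) y = (intmx Omega *m y) i 0.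
Proof.
by rewrite /hform map_delta_mx trmx_delta -mulmxA -rowE mxE.
Qed.

(** [Omega] is real and symmetric, so taking the conjugate transpose of the 1 x 1 matrix [K]
    exchanges [x] and [y]. *)
Lemma hform_conj x y : Omega^T = Omega -> hform y x = Num.conj (hform x y).
Proof.
move=> symO.
have symC : (intmx Omega)^T = intmx Omega by rewrite /intmx map_trmx symO.
have realO : map_mx Num.conj (intmx Omega) = intmx Omega.
  by apply/matrixP => j k; rewrite !mxE rmorph_int.
have conjK : map_mx Num.conj (map_mx Num.conj x) = x.
  by apply/matrixP => j k; rewrite !mxE conjCK.
rewrite /hform; set K := (map_mx Num.conj x)^T *m _ *m _.
have -> : (map_mx Num.conj y)^T *m intmx Omega *m x = (map_mx Num.conj K)^T.
  by rewrite !map_mxM -map_trmx conjK realO !trmx_mul trmxK symC mulmxA.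
by rewrite mxE mxE.
Qed.

(** Left multiplication by [delta_mx i i] keeps only row [i], so [Qmx Omega i] moves [v] along a
    single basis vector. *)
Lemma intmx_Qmx_mul i (v : 'cV[C]_N) :
  intmx (Qmx Omega i) *m v =
  v + (intmx Omega *m v) i 0 *: delta_mx i 0.
Proof.
rewrite /intmx /Qmx map_mxD map_mx1 map_mxM map_delta_mx mulmxDl mul1mx.
congr (_ + _); apply/matrixP => j k; rewrite -mulmxA !mxE ord1 eqxx andbT.
rewrite (bigD1 i) //= big1 ?addr0 => [|l /negPf li]; last first.
  by rewrite mxE li andbF mul0r.
by rewrite mxE eqxx andbT mulrC mxE.
Qed.

Hypothesis symO : Omega^T = Omega.
Hypothesis diagO : forall i, 0 <= Omega i i.

(** Expand the form at [v + c e_i] with [c = (Omega v)_i]: each of the two cross terms is [|c|^2],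
    and the term in [e_i] alone is [Omega i i * |c|^2]. *)
Lemma hform_Qmx i (v : 'cV[C]_N) :
  let Qv := intmx (Qmx Omega i) *m v in
  hform Qv Qv =
  hform v v + (2 + (Omega i i)%:~R) * `|(intmx Omega *m v) i 0| ^+ 2.
Proof.
rewrite /= intmx_Qmx_mul normCK; set c := _ i 0.
rewrite hformDl !hformDr !hformZl !hformZr.
rewrite (hform_conj (delta_mx i 0) v) // !hform_deltal -/c.
have -> : (intmx Omega *m delta_mx i 0) i (0 : 'I_1) = (Omega i i)%:~R.
  by rewrite -colE !mxE.
ring.
Qed.

Lemma matrix_monoid_hform M (v : 'cV[C]_N) : matrix_monoid Omega M ->
  hform v v <= hform (intmx M *m v) (intmx M *m v) /\
  (hform (intmx M *m v) (intmx M *m v) = hform v v -> intmx M *m v = v).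
Proof.
move=> hM; move: v; pose h v := hform v v.
(* The vector is quantified inside [P] because, for a product [A *m B], the property of [A] is
   needed at [B v]. *)
pose P A := forall v, h v <= h (intmx A *m v) /\
  (h (intmx A *m v) = h v -> intmx A *m v = v).
apply: (hM P) => {M hM}; split.
  split=> [|A B hA hB v].
    by move=> v; rewrite /intmx map_mx1 mul1mx.
  rewrite [intmx _]map_mxM -mulmxA.
  have [leB eqB] := hB v; have [leA eqA] := hA (intmx B *m v).
  split=> [|eqAB]; first exact: le_trans leA.
  (* Equality at the ends of [h v <= h (B v) <= h (A (B v))] forces equality throughout, so [B]
     fixes [v], and then so does [A]. *)
  have eB : intmx B *m v = v.
    by apply: eqB; apply/le_anti; rewrite leB -{1}eqAB leA.
  by rewrite eqA // [in RHS]eB.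
move=> _ [i _ <-] v; rewrite /h hform_Qmx.
(* As this coefficient is positive, a zero increment forces [(Omega v)_i = 0]. *)
have p_gt0 : 0 < 2 + (Omega i i)%:~R :> C.
  by rewrite ltr_wpDr // ler0z.
split=> [|/eqP]; first by rewrite lerDl mulr_ge0 ?exprn_ge0 // ltW.
rewrite addrC -subr_eq0 addrK mulf_eq0 gt_eqF //= expf_eq0 normr_eq0 /=.
by move/eqP=> c0; rewrite intmx_Qmx_mul c0 scale0r addr0.
Qed.

Lemma matrix_monoid_eigenvalue M z : matrix_monoid Omega M ->
  eigenvalue (intmx M) z -> `|z| = 1 -> z = 1.
Proof.
move=> hM hz z1.
(* [eigenvalue] refers to row eigenvectors; passing to the transpose yields a column eigenvector
   [w^T] of [M]. *)
have : eigenvalue (intmx M)^T z.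
  rewrite /eigenvalue kermx_eq0 row_free_unit -unitmx_tr linearB /= trmxK.
  by rewrite tr_scalar_mx -row_free_unit -kermx_eq0.
case/eigenvalueP=> w wM w0.
have Mv : intmx M *m w^T = z *: w^T.
  by rewrite -[LHS]trmxK trmx_mul trmxK wM linearZ.
have [_] := matrix_monoid_hform M w^T hM.
rewrite Mv hformZl hformZr mulrA [Num.conj z * z]mulrC -normCK z1 expr1n mul1r.
move=> /(_ erefl) /eqP; rewrite -subr_eq0 -{2}[w^T]scale1r -scalerBl.
by rewrite scaler_eq0 trmx_eq0 (negPf w0) orbF subr_eq0 => /eqP.
Qed.

End HermitianForm.

Section IntersectionMatrix.
Context {R : realType} {S : topologicalType}.

Lemma meet_inC (c d : R * R -> S) k : meet_in c d k -> meet_in d c k.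
Proof. by move=> [c' [d' [? ? ? ? ?]]]; exists d', c'; rewrite classical_sets.setIC. Qed.

(** Both sides apply [xget] to the same set, so they agree whether or not a minimum exists. *)
Lemma geometric_intersectionC (c d : R * R -> S) :
  geometric_intersection c d = geometric_intersection d c.
Proof.
rewrite /geometric_intersection; congr (xget _ _).
have E : meet_in c d = meet_in d c.
  by apply/funext => k; apply/propext; split; exact: meet_inC.
by rewrite E.
Qed.

Lemma intersection_matrix_sym n m (a : 'I_n -> R * R -> S)
    (b : 'I_m -> R * R -> S) :
  (intersection_matrix a b)^T = intersection_matrix a b.
Proof. by apply/matrixP => i j; rewrite !mxE geometric_intersectionC. Qed.

End IntersectionMatrix.

Theorem proposition2p3 (R : realType) (S : topologicalType) (n m : nat)
    (a : 'I_n -> R * R -> S) (b : 'I_m -> R * R -> S)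
    (hS : @is_surface R S) (ha : multicurve a) (hb : multicurve b)
    (M : 'M[int]_(n + m)) (hM : matrix_monoid (intersection_matrix a b) M)
    (z : R[i])
    (hz : eigenvalue (map_mx (fun k : int => k%:~R : R[i]) M) z)
    (hz1 : `|z| = 1) :
  z = 1.
Proof.
apply: matrix_monoid_eigenvalue hM hz hz1; first exact: intersection_matrix_sym.
(* Diagonal entries are natural numbers cast to [int], hence nonnegative. *)
by move=> i; rewrite mxE.
Qed.
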